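(* Let $G=\langle S_k\mid K\rangle$ be a finitely generated semigroup as described in the context with $K$ primitive, and suppose there is $m$ with $m=\sum_{j=1}^kK(s_i,s_j)$ for every $1\le i\le k$. Let $\mathcal{A}$ be a finite alphabet and $X=X_{\mathbf{A}}$ a hom Markov tree shift on $G$. Then the topological entropy exists and \[\lim_{n\to\infty}\frac{\log p_n}{|\Delta_n|}=h^{(s)}(X).\]
   Context: Let $K$ be a $k\times k$ matrix with entries in $\{0,1\}$ indexed by $S_k=\{s_1,\dots,s_k\}$, and let $G=\langle S_k\mid K\rangle$ be the semigroup generated by $S_k$ subject to the relations $s_is_j=1_G$ if and only if $K(s_i,s_j)=0$ ($1_G$ the identity). Every $g\in G$ has a unique minimal representation $g=g_1g_2\cdots g_n$ with $g_l\in S_k$ and $K(g_l,g_{l+1})=1$; its length is $|g|=n$ (with $|1_G|=0$). For $n\ge0$, $\Delta_n=\{h\in G:|h|\le n\}$, and for $g\in G$ the $n$-semiball is $\bar{\Delta}^{(g)}_n=\{gh: h\in G,\ |h|\le n,\ |gh|=|g|+|h|\}$. For a finite alphabet $\mathcal{A}$, a pattern is a map $u:H\to\mathcal{A}$ with $H\subset G$ finite; $u$ is accepted by $t\in\mathcal{A}^G$ if there is $g\in G$ with $t_{gh}=u_h$ for all $h\in H$. For $X\subseteq\mathcal{A}^G$, $p_n$ is the number of patterns $u\in\mathcal{A}^{\Delta_n}$ accepted by some $t\in X$, and $p^{(g)}_n$ the number of patterns $u\in\mathcal{A}^{\bar{\Delta}^{(g)}_n}$ accepted by some $t\in X$. Given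 a $k$-tuple $\mathbf{A}=(A_1,\dots,A_k)$ of $\{0,1\}$-matrices indexed by $\mathcal{A}$, the Markov tree shift is $X_{\mathbf{A}}=\{t\in\mathcal{A}^G: A_i(t_g,t_{gs_i})=1 \text{ for all } g\in G \text{ and } i \text{ with } |gs_i|=|g|+1\}$; it is a hom Markov tree shift if $A_1=A_2=\cdots=A_k$. The $i$th stem entropy is $h^{(s_i)}(X)=\limsup_{n\to\infty}\log p^{(s_i)}_n/|\bar{\Delta}^{(s_i)}_n|$; since $K$ is primitive these coincide, and $h^{(s)}(X)$ denotes their common value. A nonnegative square matrix is primitive if some power has all entries positive. *)

(* Defs.v *)
From HB Require Import structures.
From mathcomp Require Import all_boot all_order all_algebra.
From mathcomp Require Import boolp classical_sets reals ereal topology normedtype sequences exp.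
Set Implicit Arguments. Unset Strict Implicit. Unset Printing Implicit Defensive.
Import Order.TTheory GRing.Theory Num.Theory numFieldNormedType.Exports.

(* The semigroup G = <S_k | K>.  The generators s_1..s_k are 'I_k and K is a *)
(* {0,1}-matrix given as a boolean relation on 'I_k.                        *)
(* An element of G is represented by its unique minimal representation,    *)
(* i.e. a word g_1 ... g_n : seq 'I_k with K(g_l, g_(l+1)) = 1 for all l.  *)

Definition admissible (k : nat) (K : 'I_k -> 'I_k -> bool) (w : seq 'I_k) : bool :=
  sorted (fun a b => K a b) w.

(* right multiplication of a word by one generator s:
   if the word ends with a letter a with K(a,s)=0 then a s = 1 cancels,
   otherwise s is appended. *)
Definition mul1 (k : nat) (K : 'I_k -> 'I_k -> bool) (w : seq 'I_k) (s : 'I_k)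
  : seq 'I_k :=
  match w with
  | [::] => [:: s]
  | x :: w' => if K (last x w') s then rcons w s else take (size w).-1 w
  end.

Definition gmul (k : nat) (K : 'I_k -> 'I_k -> bool) (g h : seq 'I_k) : seq 'I_k :=
  foldl (mul1 K) g h.

Definition words_of_size (k m : nat) : seq (seq 'I_k) :=
  [seq tval t | t <- enum {: m.-tuple 'I_k}].

Definition Delta (k : nat) (K : 'I_k -> 'I_k -> bool) (n : nat) : seq (seq 'I_k) :=
  undup [seq w <- flatten [seq words_of_size k m | m <- iota 0 n.+1]
        | admissible K w].

Definition semiball (k : nat) (K : 'I_k -> 'I_k -> bool) (g : seq 'I_k) (n : nat)
  : seq (seq 'I_k) :=
  undup [seq gmul K g h | h <- Delta K n & size (gmul K g h) == size g + size h].

(* Markov tree shifts.  A configuration t in A^G is a function              *)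
(* t : seq 'I_k -> Alph; only its values on admissible words (= elements of *)
(* G) are ever used.  Am i is the matrix A_i indexed by the alphabet.       *)

Definition in_markov_tree_shift (k : nat) (K : 'I_k -> 'I_k -> bool)
  (Alph : finType) (Am : 'I_k -> Alph -> Alph -> bool) (t : seq 'I_k -> Alph) : Prop :=
  forall (g : seq 'I_k) (i : 'I_k), admissible K g ->
    size (gmul K g [:: i]) = (size g).+1 -> Am i (t g) (t (gmul K g [:: i])).

Definition accepted (k : nat) (K : 'I_k -> 'I_k -> bool) (Alph : finType)
  (H : seq (seq 'I_k)) (u : {ffun seq_sub H -> Alph}) (t : seq 'I_k -> Alph) : Prop :=
  exists g : seq 'I_k, admissible K g /\
    forall h : seq_sub H, t (gmul K g (ssval h)) = u h.

Definition npatterns (k : nat) (K : 'I_k -> 'I_k -> bool) (Alph : finType)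
  (Am : 'I_k -> Alph -> Alph -> bool) (H : seq (seq 'I_k)) : nat :=
  #|[set u : {ffun seq_sub H -> Alph} |
      `[< exists t, in_markov_tree_shift K Am t /\ accepted K u t >] ]|.

Definition p_n (k : nat) (K : 'I_k -> 'I_k -> bool) (Alph : finType)
  (Am : 'I_k -> Alph -> Alph -> bool) (n : nat) : nat :=
  npatterns K Am (Delta K n).

Definition p_n_semi (k : nat) (K : 'I_k -> 'I_k -> bool) (Alph : finType)
  (Am : 'I_k -> Alph -> Alph -> bool) (g : seq 'I_k) (n : nat) : nat :=
  npatterns K Am (semiball K g n).

Definition mx_of_rel (k : nat) (K : 'I_k -> 'I_k -> bool) : 'M[int]_k :=
  \matrix_(i, j) (Posz (K i j : nat)).

Definition primitive_mx (k : nat) (M : 'M[int]_k) : Prop :=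
  exists p : nat, (0 < p)%N /\
    forall i j : 'I_k, (0 < (iter p (mulmx M) 1%:M) i j)%R.

Local Open Scope ring_scope.

Definition entropy_seq (R : realType) (k : nat) (K : 'I_k -> 'I_k -> bool)
  (Alph : finType) (Am : 'I_k -> Alph -> Alph -> bool) (n : nat) : R :=
  ln ((p_n K Am n)%:R) / (size (Delta K n))%:R.

Definition stem_seq (R : realType) (k : nat) (K : 'I_k -> 'I_k -> bool)
  (Alph : finType) (Am : 'I_k -> Alph -> Alph -> bool) (i : 'I_k) (n : nat) : R :=
  ln ((p_n_semi K Am [:: i] n)%:R) / (size (semiball K [:: i] n))%:R.

Definition stem_entropy (R : realType) (k : nat) (K : 'I_k -> 'I_k -> bool)
  (Alph : finType) (Am : 'I_k -> Alph -> Alph -> bool) (i : 'I_k) : \bar R :=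
  limn_esup (fun n => (stem_seq R K Am i n)%:E).

(* Main.v *)
(* Let E be the common matrix, S_n the number of labellings of depth n of a tree
   all of whose nodes have m children (counting only symbols that start an
   infinite E-path), and geo n = 1 + m + ... + m^(n-1).  If m > 1, then
   S_(n+1) <= |A| S_n^m makes (log S_n + c) / m^n nonincreasing; if m = 1, then
   primitivity forces k = 1 and log S_n is subadditive.  Either way
   log S_n = (h + o(1)) geo (n+1) for some h.
   Patterns accepted at the identity show that p_n and the stem counts grow at
   least at rate h per node.  The delicate point is the upper bound, because a
   pattern accepted at g also sees the ancestors of g whenever g h involves
   cancellations.  All the letters that cancel at g lead to the same parent, so
   each of them costs at most m subtrees of depth one less, that is, no more than
   the subtree it replaces; only an error of order n remains, and m > 1 whenever
   a cancellation is possible. *)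
Require Import Defs.
From HB Require Import structures.
From mathcomp Require Import all_boot all_order all_algebra.
From mathcomp Require Import boolp classical_sets reals ereal topology normedtype sequences exp.
From mathcomp Require Import zify ring lra.
Import Order.TTheory GRing.Theory Num.Theory numFieldNormedType.Exports.
Set Implicit Arguments.
Unset Strict Implicit.
Unset Printing Implicit Defensive.

(** * Labellings of subtrees and the number of their patterns *)

Section TreeFamilies.
Variables (k : nat) (K : 'I_k -> 'I_k -> bool).
Variables (Alph : finType) (E : Alph -> Alph -> bool).
Local Notation word := (seq 'I_k).

Definition okword (Q : pred 'I_k) (w : word) : bool :=
  if w is j :: w' then Q j && path K j w' else true.

Definition wordball (Q : pred 'I_k) (n : nat) : pred word :=
  fun w => okword Q w && (size w <= n)%N.

Lemma wordballE Q n w : (w \in wordball Q n) = okword Q w && (size w <= n)%N.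
Proof. by []. Qed.

Lemma wordball_cons Q n j w :
  (j :: w \in wordball Q n.+1) = Q j && (w \in wordball (K j) n).
Proof. by rewrite !wordballE /= ltnS -andbA; case: w. Qed.

(* Labellings of the subtree below a node all of whose children lie in [Q];
   for [Q := K i] this is the subtree rooted at any element ending in [i]. *)
Definition treefam (Q : pred 'I_k) (a : Alph) (f : word -> Alph) : Prop :=
  f [::] = a /\
  forall w s, okword Q (rcons w s) -> E (f w) (f (rcons w s)).

Definition infinite_path (x : nat -> Alph) : Prop := forall n, E (x n) (x n.+1).

(** These are the symbols that can label the root of an infinite tree; all others contribute no
    pattern. *)
Definition alive (a : Alph) : bool :=
  `[< exists2 x, x 0%N = a & infinite_path x >].

(** A labelling splits at the root into independent labellings of the child subtrees; this
    independence turns counts into products. *)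
Lemma treefamP Q a f :
  treefam Q a f <->
  f [::] = a /\ forall j, Q j ->
    E a (f [:: j]) /\ treefam (K j) (f [:: j]) (fun w => f (j :: w)).
Proof.
split=> -[f0 fE]; split=> //.
  move=> j Qj; split; first by rewrite -f0; apply: (fE [::]); rewrite /= Qj.
  split=> // w s ws; apply: (fE (j :: w)); rewrite /= Qj /=.
  by case: w ws => //= l w /andP[-> ].
move=> [|j w] s /=.
  by rewrite andbT => /fE[]; rewrite f0.
case/andP=> /fE[_ [_ fj]] ws; apply: fj.
by case: w ws => //= l w ->.
Qed.

(** Following one allowed successor after another gives a ray of the tree, whose labels form an
    infinite [E]-path. *)
Lemma treefam_alive (Q : pred _) j a f :
  (forall i, exists j, K i j) -> Q j -> treefam Q a f -> alive a.
Proof.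
move=> /fin_all_exists[nxt Knxt] Qj [f0 fE].
apply/asboolP; exists (fun n => f (traject nxt j n)) => // n.
rewrite trajectSr; apply: fE; rewrite -trajectSr /= Qj /=.
by elim: n j {Qj} => //= n IHn j; rewrite Knxt IHn.
Qed.

(** Branches outside [Q] leave the tree at the root only, so their nodes can be labelled by depth
    along one infinite path from [a]. *)
Lemma alive_extend Q a f : alive a -> treefam Q a f ->
  exists2 t, treefam predT a t & {in okword Q, t =1 f}.
Proof.
move=> /asboolP[x x0 xE] [f0 fE].
exists (fun w => if okword Q w then f w else x (size w)); last by move=> w wQ; rewrite ifT.
split=> // -[|j w] s /=.
  rewrite andbT => _; case: ifP => Qs; first by apply: (fE [::]); rewrite /= Qs.
  by rewrite f0 -x0; apply: xE.
move=> ws; rewrite ws; move: ws; rewrite rcons_path => /andP[jw ws].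
rewrite jw !andbT; case: ifP => Qj; last by rewrite size_rcons; apply: xE.
by apply: (fE (j :: w)); rewrite /= Qj rcons_path jw.
Qed.

Lemma alive_treefam Q a : alive a -> exists f, treefam Q a f.
Proof.
move=> /asboolP[x x0 xE]; exists (fun w => x (size w)); split=> // w s _.
by rewrite size_rcons; apply: xE.
Qed.

(** Expresses that [F] has exactly [#|I|] restrictions to [D]. Representatives are total labellings,
    so that they can be glued and extended. *)
Definition transversal_by (I : finType) (F : (word -> Alph) -> Prop) (D : pred word)
    (r : I -> word -> Alph) : Prop :=
  [/\ forall x, F (r x),
      forall x y, {in D, r x =1 r y} -> x = y &
      forall f, F f -> exists x, {in D, f =1 r x}].

Definition has_patterns (F : (word -> Alph) -> Prop) (D : pred word) (N : nat) : Prop :=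
  exists (I : finType) (r : I -> word -> Alph),
    #|I| = N /\ transversal_by F D r.

(** With an index type that depends on the count only, finite choice can pick transversals for all
    letters and symbols at once. *)
Lemma has_patterns_ord F D N : has_patterns F D N ->
  exists r : 'I_N -> word -> Alph, transversal_by F D r.
Proof.
move=> [I [r [<- [rF rI rS]]]]; exists (fun x => r (enum_val x)); split=> //.
  by move=> x y /rI/enum_val_inj.
by move=> f /rS[x fx]; exists (enum_rank x); rewrite enum_rankK.
Qed.

(** Each letter of [Q] independently chooses a successor [b] of [a] and a pattern of depth [n]
    rooted at [b]. *)
Lemma has_patterns_step (Q : pred 'I_k) a n (B : Alph -> nat) :
  (forall j b, has_patterns (treefam (K j) b) (wordball (K j) n) (B b)) ->
  has_patterns (treefam Q a) (wordball Q n.+1) ((\sum_(b | E a b) B b) ^ #|Q|).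
Proof.
move=> HB.
have /fin_all_exists[r0 r0P] : forall j, exists r : forall b, 'I_(B b) -> word -> Alph,
    forall b, transversal_by (treefam (K j) b) (wordball (K j) n) (r b).
  move=> j; apply: (fin_all_exists (P := fun b (r : 'I_(B b) -> word -> Alph) =>
    transversal_by (treefam (K j) b) (wordball (K j) n) r)) => b.
  exact/has_patterns_ord/HB.
pose J := {j | Q j}; pose C := {b : {b | E a b} & 'I_(B (val b))}.
pose r (x : {ffun J -> C}) (w : word) := if w is j :: w' then
  if insub j is Some j' then r0 j (val (tag (x j'))) (tagged (x j')) w' else a else a.
exists {ffun J -> C}, r; split.
  rewrite card_ffun card_sig card_tagged sumnE big_map big_enum /=.
  congr (_ ^ _); rewrite (eq_bigr (fun b : {b | E a b} => B (val b))).
    exact/esym/(big_sub (E a)).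
  by move=> b _; rewrite card_ord.
split.
- move=> x; apply/treefamP; split=> // j Qj; rewrite /r insubT /=.
  case: (x _) => -[b Eab] y /=.
  have [/(_ y) ry _ _] := r0P j b; have := ry => -[r1 _].
  by rewrite r1.
- move=> x y xy; apply/ffunP=> -[j Qj].
  have {xy} : {in wordball (K j) n, forall w, r x (j :: w) = r y (j :: w)}.
    by move=> w wB; apply: xy; rewrite wordball_cons; apply/andP.
  rewrite /r insubT /=; case: (x _) => -[b Eb] z; case: (y _) => -[b' Eb'] z' /= zz'.
  (* The empty word reads off the label of the child, so both choices start with the same symbol. *)
  have bb' : b = b'.
    have := zz' [::] isT.
    have [/(_ z)[-> _] _ _] := r0P j b.
    by have [/(_ z')[-> _] _ _] := r0P j b'.
  case: _ / bb' in Eb' z' zz' *; rewrite (bool_irrelevance Eb' Eb); congr (Tagged _ _).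
  by have [_ + _] := r0P j b; apply.
- move=> f /treefamP[f0 fE].
  have /fin_all_exists[x xP] : forall j : J, exists c : C,
      {in wordball (K (val j)) n, (fun w => f (val j :: w)) =1 r0 (val j) (val (tag c)) (tagged c)}.
    move=> [j Qj]; have [Ej fj] := fE j Qj.
    have [_ _ /(_ _ fj)[y yP]] := r0P j (f [:: j]).
    pose b : {b | E a b} := exist _ (f [:: j]) Ej.
    by exists (Tagged (fun b : {b | E a b} => 'I_(B (val b))) (y : 'I_(B (val b)))).
  exists (finfun x) => -[_|j w] //; rewrite wordball_cons => /andP[Qj jw].
  by rewrite /r insubT ffunE; apply: (xP (exist _ j Qj)).
Qed.

(** Counts the depth-[n] patterns rooted at [a] on an [m]-ary tree; the initial value [alive a],
    instead of 1, discards those without an infinite extension. *)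
Fixpoint tcount (m n : nat) (a : Alph) : nat :=
  if n is n'.+1 then (\sum_(b | E a b) tcount m n' b) ^ m else alive a.

Lemma has_patterns_tcount m i a n :
  (0 < m)%N -> (forall i, #|K i| = m) ->
  has_patterns (treefam (K i) a) (wordball (K i) n) (tcount m n a).
Proof.
move=> m0 Km.
have nxt j : exists l, K j l.
  by have /card_gt0P[l Kl] : (0 < #|K j|)%N; [rewrite Km|exists l].
elim: n i a => [|n IHn] i a; last first.
  rewrite /= -[X in _ ^ X](Km i); apply: has_patterns_step => j b; exact: IHn.
rewrite /=; case: (boolP (alive a)) => [al|nal].
  have [f fP] := alive_treefam (K i) al.
  exists unit, (fun=> f); rewrite card_unit; split=> //; split=> //.
    by move=> [] [].
  move=> g [g0 _]; exists tt => -[|w l] /=; last by rewrite wordballE andbF.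
  by case: fP => -> _.
(* Every letter has a successor, so a dead root has no labelling and the empty transversal is
   complete. *)
exists void, (fun v => of_void _ v); rewrite card_void; split=> //; split=> //.
by move=> f fP; have [l Kl] := nxt i; move: nal; rewrite (treefam_alive nxt Kl fP).
Qed.

End TreeFamilies.

(** * Cancellation in the semigroup, balls and semiballs *)

Section Multiplication.
Variables (k : nat) (K : 'I_k -> 'I_k -> bool).
Local Notation word := (seq 'I_k).

(** [None] is the missing last letter of the identity, to which every generator can be appended. *)
Definition appends (l : option 'I_k) : pred 'I_k :=
  if l is Some a then K a else predT.

Definition last_letter (g : word) : option 'I_k :=
  if g is x :: g' then Some (last x g') else None.

Lemma mul1_append g j : appends (last_letter g) j -> mul1 K g j = rcons g j.
Proof. by case: g => //= x g ->. Qed.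

Lemma mul1_cancel g j :
  ~~ appends (last_letter g) j -> mul1 K g j = take (size g).-1 g.
Proof. by case: g => //= x g /negPf->. Qed.

Lemma admissible_rcons g j :
  admissible K (rcons g j) = admissible K g && appends (last_letter g) j.
Proof. by case: g => //= x g; rewrite /admissible /= rcons_path. Qed.

Lemma admissible_cat g h : admissible K (g ++ h) -> admissible K g.
Proof. by case: g => //= x g; rewrite /admissible /= cat_path => /andP[]. Qed.

Lemma admissible_rcons_cat g j w :
  admissible K (rcons g j) -> okword K (K j) w -> admissible K (rcons g j ++ w).
Proof.
case: g => [|x g]; rewrite /admissible /= => gj jw; first by case: w jw.
by rewrite cat_path gj last_rcons; case: w jw.
Qed.

Lemma gmul_cat g h : admissible K (g ++ h) -> gmul K g h = g ++ h.
Proof.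
elim: h g => [|j h IHh] g; first by rewrite cats0.
rewrite -cat_rcons => gh.
have := admissible_cat gh; rewrite admissible_rcons => /andP[_ gj].
by rewrite -(IHh _ gh) /gmul /= mul1_append.
Qed.

Lemma size_mul1_le g j : (size (mul1 K g j) <= (size g).+1)%N.
Proof.
case: (boolP (appends (last_letter g) j)) => gj.
  by rewrite mul1_append ?size_rcons.
by rewrite mul1_cancel ?size_take //; case: ifP => _; lia.
Qed.

Lemma size_gmul_le g h : (size (gmul K g h) <= size g + size h)%N.
Proof.
elim: h g => [|j h IHh] g /=; first by rewrite addn0.
apply: leq_trans (IHh _) _; have := size_mul1_le g j; lia.
Qed.

Lemma size_gmul1 g j :
  (size (gmul K g [:: j]) == (size g).+1) = appends (last_letter g) j.
Proof.
case: (boolP (appends (last_letter g) j)) => gj; rewrite /gmul /=.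
  by rewrite mul1_append ?size_rcons ?eqxx.
by rewrite mul1_cancel ?size_take //; apply/negbTE; case: ifP => _; lia.
Qed.

(** A cancelling first letter shortens [g], and the remaining letters cannot make up for the
    loss. *)
Lemma size_gmul_head g h : (size (gmul K g h) == size g + size h)%N ->
  if h is j :: h' then appends (last_letter g) j else true.
Proof.
case: h => // j h; apply: contraLR => gj /=.
have := size_gmul_le (mul1 K g j) h; rewrite mul1_cancel // size_take.
by case: ifP => _; lia.
Qed.

Lemma mem_Delta n w :
  (w \in Delta K n) = (w \in wordball K predT n).
Proof.
rewrite mem_undup mem_filter wordballE; have -> : okword K predT w = admissible K w by case: w.
congr (_ && _); apply/flatten_mapP/idP.
  move=> [m]; rewrite mem_iota /= add0n ltnS => mn /mapP[t _ ->].
  by rewrite size_tuple.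
move=> wn; exists (size w); first by rewrite mem_iota.
by apply/mapP; exists (in_tuple w); rewrite ?mem_enum.
Qed.

(** Once the first letter of an admissible [h] is appended, no later one cancels, so [gmul] is
    concatenation here. *)
Lemma mem_semiball i n w : (w \in semiball K [:: i] n) =
  if w is j :: h then (j == i) && (h \in wordball K (K i) n) else false.
Proof.
rewrite mem_undup; apply/mapP/idP.
  move=> [h]; rewrite mem_filter mem_Delta wordballE => /andP[/size_gmul_head hi /andP[hP hn]].
  have ih : admissible K ([:: i] ++ h).
    by case: h hi hP {hn} => //= j h; rewrite /admissible /= => ->.
  move=> ->; rewrite gmul_cat //= eqxx wordballE hn andbT.
  by case: h hi hP {hn ih} => //= j h ->.
case: w => // j h /andP[/eqP-> ]; rewrite wordballE => /andP[ih hn].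
have ih' : admissible K ([:: i] ++ h) by case: h ih {hn}.
exists h; last by rewrite gmul_cat.
rewrite mem_filter gmul_cat //= eqxx mem_Delta wordballE hn andbT /=.
by case: h ih {hn ih'} => //= l h /andP[_].
Qed.

Fixpoint geo (m n : nat) : nat := if n is n'.+1 then (m * geo m n').+1 else 0.

(** This enumeration follows the tree recursion, so that ball sizes can be computed by induction on
    the depth. *)
Fixpoint ball_seq (n : nat) (Q : {set 'I_k}) : seq word :=
  [::] :: if n is n'.+1
  then flatten [seq [seq j :: w | w <- ball_seq n' [set l | K j l]] | j <- enum Q]
  else [::].

Lemma mem_ball_seq n Q w : (w \in ball_seq n Q) = (w \in wordball K (mem Q) n).
Proof.
elim: n Q w => [|n IHn] Q [|j w] //=; rewrite !inE /=; first by rewrite wordballE andbF.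
rewrite wordball_cons; apply/flatten_mapP/andP.
  move=> [l lQ /mapP[v]]; rewrite IHn => vP [-> ->].
  rewrite mem_enum in lQ; split=> //; move: vP; rewrite !wordballE.
  by case: v => //= x v; rewrite inE.
move=> [jQ wP]; exists j; first by rewrite mem_enum.
apply/mapP; exists w => //; rewrite IHn; move: wP; rewrite !wordballE.
by case: w => //= x w; rewrite inE.
Qed.

Lemma ball_seq_uniq n Q : uniq (ball_seq n Q).
Proof.
elim: n Q => //= n IHn Q; apply/andP; split.
  by apply/flatten_mapP => -[j _ /mapP[]].
have := enum_uniq Q; elim: (enum Q) => //= j s IHs /andP[js su].
rewrite cat_uniq IHs // map_inj_uniq ?IHn ?andbT; last by move=> ? ? [].
apply/hasPn => w /flatten_mapP[l ls /mapP[v _ ->]]; apply/mapP => -[u _ [lj _]].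
by rewrite -lj ls in js.
Qed.

Variable m : nat.
Hypothesis Km : forall i, #|K i| = m.

Lemma size_ball_seq n Q : size (ball_seq n Q) = (1 + #|Q| * geo m n)%N.
Proof.
elim: n Q => [|n IHn] Q /=; first by rewrite muln0.
rewrite size_flatten /shape -map_comp sumnE big_map.
rewrite (eq_bigr (fun=> (m * geo m n).+1)); last first.
  move=> j _ /=; rewrite size_map IHn add1n; congr (_ * _).+1.
  by rewrite -(Km j); apply: eq_card => l; rewrite inE.
by rewrite big_const_seq count_predT iter_addn_0 -cardE mulnC.
Qed.

Lemma size_Delta n : size (Delta K n) = (1 + k * geo m n)%N.
Proof.
rewrite -[X in (X * _)%N](card_ord k) -cardsT -size_ball_seq; apply: perm_size.
apply: uniq_perm; rewrite ?undup_uniq ?ball_seq_uniq // => w.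
by rewrite mem_Delta mem_ball_seq !wordballE; case: w => //= j w; rewrite inE.
Qed.

Lemma size_semiball i n : size (semiball K [:: i] n) = geo m n.+1.
Proof.
have -> : geo m n.+1 = size [seq i :: w | w <- ball_seq n [set l | K i l]].
  rewrite size_map size_ball_seq add1n /=; congr (_ * _).+1.
  by rewrite -(Km i); apply: eq_card => l; rewrite inE.
apply/perm_size/uniq_perm; rewrite ?undup_uniq //.
  by rewrite map_inj_uniq ?ball_seq_uniq // => ? ? [].
move=> w; rewrite mem_semiball; apply/idP/mapP.
  case: w => // j w /andP[/eqP-> wP]; exists w => //; rewrite mem_ball_seq.
  by move: wP; rewrite !wordballE; case: w => //= x w; rewrite inE.
move=> [v vP ->]; rewrite eqxx; move: vP; rewrite mem_ball_seq !wordballE.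
by case: v => //= x v; rewrite inE.
Qed.

End Multiplication.

(** * Covering the patterns seen from an arbitrary element *)

Section Covers.
Variables (k : nat) (K : 'I_k -> 'I_k -> bool).
Variables (Alph : finType) (E : Alph -> Alph -> bool).
Local Notation word := (seq 'I_k).
Local Notation pattern_family := ((word -> Alph) -> Prop).

(** The upper-bound half of [has_patterns]: representatives may lie outside [F] and may repeat. *)
Definition covered (F : pattern_family) (D : pred word) (N : nat) : Prop :=
  exists (I : finType) (r : I -> word -> Alph),
    #|I| = N /\ forall f, F f -> exists x, {in D, f =1 r x}.

Lemma covered_patterns F D N : has_patterns F D N -> covered F D N.
Proof. by move=> [I [r [cI [_ _ rS]]]]; exists I, r. Qed.

Lemma covered_sub (F F' : pattern_family) D N :
  (forall f, F f -> F' f) -> covered F' D N -> covered F D N.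
Proof. by move=> FF' [I [r [cI rS]]]; exists I, r; split=> // f /FF'/rS. Qed.

Lemma covered_union (J : finType) (F : J -> pattern_family) D (N : J -> nat) :
  (forall j, covered (F j) D (N j)) ->
  covered (fun f => exists j, F j f) D (\sum_j N j).
Proof.
move=> /fin_all_exists[I /fin_all_exists[r rP]].
exists {j : J & I j}, (fun x => r (tag x) (tagged x)); split.
  rewrite card_tagged sumnE big_map big_enum /=.
  by apply: eq_bigr => j _; have [] := rP j.
move=> f [j Fjf]; have [_ /(_ f Fjf)[x fx]] := rP j.
by exists (Tagged I x).
Qed.

(** Only words that continue [j] without cancellation are constrained; a translate has values at
    other words too. *)
Definition subtree_family (j : 'I_k) : pattern_family :=
  fun f => exists b f', treefam K E (K j) b f' /\ {in okword K (K j), f =1 f'}.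

Definition subtree_count (m n : nat) : nat := \sum_a tcount E m n a.

Lemma covered_subtree m j n : (0 < m)%N -> (forall i, #|K i| = m) ->
  covered (subtree_family j) (wordball K (K j) n) (subtree_count m n).
Proof.
move=> m0 Km.
have [I [r [cI rS]]] : covered (fun f => exists b, treefam K E (K j) b f)
    (wordball K (K j) n) (subtree_count m n).
  by apply: covered_union => b; apply/covered_patterns/has_patterns_tcount.
exists I, r; split=> // f [b [f' [f'b ff']]].
have [|x xP] := rS f'; first by exists b.
by exists x => w wP; rewrite -xP // ff'; case/andP: wP.
Qed.

(* If [f] is labelled by a translate based at [g], the letters of [L] prolong
   [g] and lead to genuine subtrees, whereas all the other ones cancel the last
   letter of [g] and hence lead to one and the same translate. *)
Lemma covered_step (F : pattern_family) (G : pattern_family) (Q : {set 'I_k})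
    (L : pred 'I_k) n S N :
  (forall j, covered (subtree_family j) (wordball K (K j) n) S) ->
  covered G (wordball K (mem (\bigcup_(j in [set j in Q | ~~ L j]) [set l | K j l])) n) N ->
  (forall f, F f -> (forall j, L j -> subtree_family j (fun w => f (j :: w))) /\
     exists2 f', G f' & forall j w, ~~ L j -> f (j :: w) = f' w) ->
  covered F (wordball K (mem Q) n.+1) (#|Alph| * S ^ #|[set j in Q | L j]| * N).
Proof.
move=> /fin_all_exists[I /fin_all_exists[r rP]] [I' [r' [<- r'P]]] FP.
set Q1 := [set j in Q | L j].
pose U := {j | j \in Q1}.
have cI j : #|I j| = S by have [] := rP j.
pose T := {dffun forall u : U, I (val u)}.
(* An index records the root label, one subtree pattern per prolonging letter, and a single pattern
   at the parent serving all cancelling letters. *)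
exists (Alph * T * I')%type, (fun (x : Alph * T * I') w =>
  if w is j :: w' then
    if insub j is Some u then r (val u) (x.1.2 u) w' else r' x.2 w'
  else x.1.1).
rewrite !card_prod card_dep_ffun foldrE big_map big_enum /=; split.
  rewrite (eq_bigr (fun=> S)) => [|u _]; last exact: cI.
  by rewrite prod_nat_const card_sig.
move=> f /FP[fL [f' /r'P[x xP] ff']].
have /fin_all_exists[y yP] : forall u : U, exists y : I (val u),
    {in wordball K (K (val u)) n, (fun w => f (val u :: w)) =1 r (val u) y}.
  move=> [j jQ1] /=; have [_] := rP j; apply; apply: fL.
  by move: jQ1; rewrite inE => /andP[].
exists (f [::], finfun y, x) => -[|j w] //; rewrite wordball_cons => /andP[jQ jw] /=.
case: insubP => [u _ uj|jQ1]; first by rewrite ffunE -uj; apply: yP; rewrite uj.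
have jL : ~~ L j by move: jQ1; rewrite inE [j \in Q]jQ.
(* What is read after the cancelling [j] starts with a letter allowed after [j], hence one in the
   union. *)
rewrite ff' //; apply: xP; move: jw; rewrite !wordballE => /andP[jw ->]; rewrite andbT.
case: w jw => //= l w /andP[jl ->]; rewrite andbT.
by apply/bigcupP; exists j; rewrite !inE ?jL ?andbT.
Qed.

(** Views of a point of the shift from [g], cancellations included; accepted patterns are
    restrictions of these. *)
Definition translates : pattern_family := fun f => exists t g,
  [/\ treefam K E predT (t [::]) t, admissible K g & f = fun h => t (gmul K g h)].

Lemma treefam_shift t g j : treefam K E predT (t [::]) t ->
  admissible K (rcons g j) -> treefam K E (K j) (t (rcons g j)) (fun w => t (rcons g j ++ w)).
Proof.
move=> [_ tE] gj; split; first by rewrite cats0.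
move=> w s ws; rewrite -rcons_cat; apply: tE; rewrite rcons_cat.
by have := admissible_rcons_cat gj ws; case: (_ ++ _).
Qed.

(** Here [l] is the last letter of [g] and [f'] the view from its parent. That view is again a
    translate, so the recursion closes up. *)
Lemma translates_split f : translates f -> exists l : option 'I_k,
  (forall j, appends K l j -> subtree_family j (fun w => f (j :: w))) /\
  exists2 f', translates f' & forall j w, ~~ appends K l j -> f (j :: w) = f' w.
Proof.
move=> [t [g [tE gP ->]]]; exists (last_letter g); split.
  move=> j gj; have gjP : admissible K (rcons g j) by rewrite admissible_rcons gP.
  exists (t (rcons g j)), (fun w => t (rcons g j ++ w)); split.
    exact: treefam_shift.
  move=> w jw; rewrite -(gmul_cat (K := K)); first by rewrite /gmul /= mul1_append.
  exact: admissible_rcons_cat.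
exists (fun h => t (gmul K (take (size g).-1 g) h)); last first.
  by move=> j w gj; rewrite /gmul /= mul1_cancel.
exists t, (take (size g).-1 g); split=> //.
by move: gP; rewrite -[g in admissible K g](cat_take_drop (size g).-1) => /admissible_cat.
Qed.

Lemma covered_root Q F : covered F (wordball K Q 0) #|Alph|.
Proof.
exists Alph, (fun a _ => a); split=> // f _.
by exists (f [::]) => -[|j w] //; rewrite wordballE andbF.
Qed.

(** The length grows by one exactly when the generator is appended, that is, along an edge of the
    tree. *)
Lemma shiftP (Am : 'I_k -> Alph -> Alph -> bool) t : (forall i, Am i = E) ->
  in_markov_tree_shift K Am t <-> treefam K E predT (t [::]) t.
Proof.
move=> AmE; split.
  move=> tX; split=> // w s ws.
  have : admissible K (rcons w s) by case: w ws.
  rewrite admissible_rcons => /andP[wP ws'].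
  rewrite -(AmE s) -(mul1_append ws'); apply: (tX w s wP); apply/eqP.
  by rewrite size_gmul1.
move=> [_ tE] g i gP /eqP; rewrite size_gmul1 => gi.
rewrite AmE /gmul /= mul1_append //; apply: tE.
have : admissible K (rcons g i) by rewrite admissible_rcons gP.
by case: (rcons g i).
Qed.

Lemma npatterns_le (Am : 'I_k -> Alph -> Alph -> bool) H D N : (forall i, Am i = E) ->
  covered translates D N -> {subset H <= D} -> (npatterns K Am H <= N)%N.
Proof.
move=> AmE [I [r [<- rP]]] HD.
pose F x := [ffun h : seq_sub H => r x (ssval h)].
rewrite /npatterns; apply: leq_trans (leq_imset_card F predT).
apply/subset_leq_card/fintype.subsetP => u; rewrite inE.
move=> /asboolP[t [/(shiftP _ AmE) tX [g [gP tu]]]].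
have [|x xP] := rP (fun h => t (gmul K g h)); first by exists t, g.
apply/imsetP; exists x => //; apply/ffunP => h; rewrite ffunE -tu xP //.
exact/HD/ssvalP.
Qed.

(** Patterns are accepted at the identity, from which admissible words are reached without
    cancellation. *)
Lemma npatterns_ge (Am : 'I_k -> Alph -> Alph -> bool) (H : seq word) (I : finType)
    (r : I -> word -> Alph) : (forall i, Am i = E) ->
  (forall x, treefam K E predT (r x [::]) (r x)) ->
  (forall w, w \in H -> admissible K w) ->
  (forall x y, {in H, r x =1 r y} -> x = y) ->
  (#|I| <= npatterns K Am H)%N.
Proof.
move=> AmE rX HP rI.
pose F x := [ffun h : seq_sub H => r x (ssval h)].
have FI : injective F.
  move=> x y /ffunP xy; apply: rI => w wH.
  by have := xy (SeqSub wH); rewrite !ffunE.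
rewrite /npatterns -(card_codom FI); apply/subset_leq_card/fintype.subsetP => u /codomP[x ->].
rewrite inE; apply/asboolP; exists (r x); split; first exact/shiftP.
exists [::]; split=> // h; rewrite ffunE gmul_cat //; exact/HP/ssvalP.
Qed.

End Covers.

(** * Primitivity and the recursion for subtree counts *)

Section Counting.
Variables (k : nat) (K : 'I_k -> 'I_k -> bool).
Variables (Alph : finType) (E : Alph -> Alph -> bool).

Lemma row_card i : (\sum_(j < k) (K i j : nat))%N = #|K i|.
Proof. by rewrite -sum1_card [RHS]big_mkcond. Qed.

(** Every row of the [p]-th power sums to [m ^ p], and each of its [k] entries is at least 1. *)
Lemma primitive_card_le m : (forall i, #|K i| = m) -> primitive_mx (mx_of_rel K) ->
  exists2 p, (0 < p)%N & (0 < k -> k <= m ^ p)%N.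
Proof.
move=> Km [p [p0 Kp]]; exists p => // k0.
have rows q i : (\sum_j (iter q (mulmx (mx_of_rel K)) 1%:M) i j = Posz (m ^ q)%N)%R.
  elim: q i => [|q IHq] i /=.
    rewrite (bigD1 i) //= mxE eqxx big1 ?addr0 // => j ji.
    by rewrite mxE eq_sym (negbTE ji).
  under eq_bigr do rewrite mxE.
  rewrite exchange_big /=; under eq_bigr do rewrite -mulr_sumr IHq mxE.
  rewrite -mulr_suml expnS PoszM -(Km i) -row_card.
  by rewrite (big_morph Posz PoszD (erefl _)).
have := rows p (Ordinal k0) => /(congr1 (fun z : int => (Posz k <= z)%R)).
rewrite lez_nat => <-; rewrite -[X in Posz X]card_ord -sum1_card.
rewrite (big_morph Posz PoszD (erefl _)); apply: ler_sum => j _.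
by have := Kp (Ordinal k0) j; lia.
Qed.

Variable m : nat.
Hypothesis m0 : (0 < m)%N.
Local Notation S := (subtree_count E m).
Local Notation z n a := (\sum_(b | E a b) tcount E m n b).

Lemma tcount_sum_le n a : (z n a <= S n)%N.
Proof. by rewrite big_mkcond; apply: leq_sum => b _; case: ifP. Qed.

Lemma subtree_count_step n : (S n.+1 <= #|Alph| * S n ^ m)%N.
Proof.
rewrite -sum_nat_const; apply: leq_sum => a _ /=.
by rewrite leq_exp2r // tcount_sum_le.
Qed.

(** A maximising symbol bounds every summand. This transfers lower bounds for [S] to a single root
    label, below which the subtrees are independent. *)
Lemma subtree_count_max n (a0 : Alph) :
  exists a, (S n.+1 <= #|Alph| * z n a ^ m)%N.
Proof.
case: (@arg_maxnP _ a0 xpredT (fun a => z n a)) => // a _ amax; exists a.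
rewrite -sum_nat_const; apply: leq_sum => b _ /=.
by rewrite leq_exp2r //; apply: amax.
Qed.

Lemma alive_cons a b : E a b -> alive E b -> alive E a.
Proof.
move=> ab /asboolP[x x0 xE]; apply/asboolP.
by exists (fun n => if n is n'.+1 then x n' else a) => // -[|n] //; rewrite x0.
Qed.

(** A dead symbol has only dead successors, so the value 0 at depth 0 propagates. *)
Lemma tcount_dead n a : ~~ alive E a -> tcount E m n a = 0%N.
Proof.
elim: n a => [|n IHn] a /=; first by move=> /negbTE->.
move=> dead; rewrite big1 ?exp0n // => b ab; apply: IHn.
by apply: contra dead; apply: alive_cons.
Qed.

Lemma tcount_gt0 n a : alive E a -> (0 < tcount E m n a)%N.
Proof.
elim: n a => [|n IHn] a; first by move=> /= ->.
move=> /asboolP[x x0 xE]; rewrite expn_gt0 (bigD1 (x 1%N)) /=; last by rewrite -x0.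
by rewrite addn_gt0 IHn //; apply/asboolP; exists (fun n => x n.+1).
Qed.

Lemma subtree_count_gt0 n a : alive E a -> (0 < S n)%N.
Proof.
by move=> al; rewrite /subtree_count (bigD1 a) //= addn_gt0 tcount_gt0.
Qed.

(** For [m = 1] the patterns are paths, and cutting one after [n] steps leaves a path of each
    length. *)
Lemma subtree_count_submul n l : m = 1%N -> (S (n + l) <= S n * S l)%N.
Proof.
move=> m1; rewrite big_distrl /=; apply: leq_sum => a _.
elim: n a => [|n IHn] a.
  case: (boolP (alive E a)) => al; last by rewrite tcount_dead.
  by rewrite /= al mul1n /subtree_count (bigD1 a) //= leq_addr.
rewrite addSn /= m1 !expn1 -m1 big_distrl /=.
by apply: leq_sum => b _; apply: IHn.
Qed.

End Counting.

(** * Lower bounds from patterns accepted at the identity *)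

Section Bounds.
Variables (k : nat) (K : 'I_k -> 'I_k -> bool).
Variables (Alph : finType) (E : Alph -> Alph -> bool) (Am : 'I_k -> Alph -> Alph -> bool).
Hypothesis AmE : forall i, Am i = E.
Variable m : nat.
Hypotheses (m0 : (0 < m)%N) (Km : forall i, #|K i| = m).
Local Notation word := (seq 'I_k).
Local Notation S := (subtree_count E m).
Local Notation z n a := (\sum_(b | E a b) tcount E m n b).

Lemma row_nonempty i : exists j, K i j.
Proof. by have /card_gt0P[j] : (0 < #|K i|)%N; [rewrite Km|exists j]. Qed.

(** All labellings counted carry [a] at the root, so they remain distinct on an [H] that omits the
    root, such as a semiball. *)
Lemma treefam_ge n a (Q : pred 'I_k) (j : 'I_k) (H : seq word) : Q j ->
  {in H, forall w, admissible K w} ->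
  (forall w, w \in wordball K Q n.+1 -> w = [::] \/ w \in H) ->
  (z n a ^ #|Q| <= npatterns K Am H)%N.
Proof.
move=> Qj HP QH.
have [r [rF rI _]] := has_patterns_ord (has_patterns_step Q a
  (fun j b => has_patterns_tcount E j b n m0 Km)).
have /fin_all_exists[t tP] : forall x, exists t,
    treefam K E predT a t /\ {in okword K Q, t =1 r x}.
  move=> x; have al := treefam_alive row_nonempty Qj (rF x).
  by have [t] := alive_extend al (rF x); exists t.
rewrite -[X in (X <= _)%N]card_ord; apply: (npatterns_ge AmE (r := t)) => //.
  by move=> x; have [tx _] := tP x; have [-> _] := tx.
move=> x y txy; apply: rI => w wQ.
have [tx rx] := tP x; have [ty ry] := tP y.
have wQ' : w \in okword K Q by case/andP: wQ.
rewrite -rx // -ry //; case: (QH w wQ) => [->|]; last exact: txy.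
by case: tx ty => -> _ [-> _].
Qed.

Lemma p_n_ge n a : (0 < k)%N -> (z n a ^ k <= p_n K Am n.+1)%N.
Proof.
move=> k0; have -> : z n a ^ k = z n a ^ #|@predT 'I_k| by rewrite card_ord.
apply: (@treefam_ge _ _ _ (Ordinal k0)) => // w.
  by rewrite mem_Delta wordballE => /andP[]; case: w.
by right; rewrite mem_Delta.
Qed.

(** The symbol [a] sits at the identity, just above the semiball, and [i] is the only first letter
    allowed. *)
Lemma p_n_semi_ge n a i : (z n a <= p_n_semi K Am [:: i] n)%N.
Proof.
rewrite -[X in (X <= _)%N]expn1 -(card1 i).
apply: (@treefam_ge _ _ (pred1 i) i) => // [|w|[|j w]]; first exact/eqP.
- by rewrite mem_semiball; case: w => // j h /andP[/eqP->]; rewrite wordballE => /andP[]; case: h.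
- by left.
by rewrite wordball_cons => /andP[/eqP-> iw]; right; rewrite mem_semiball eqxx.
Qed.

Lemma no_patterns H : (0 < k)%N -> (forall a, ~~ alive E a) -> npatterns K Am H = 0%N.
Proof.
move=> k0 noal; apply/eqP; rewrite -leqn0.
apply: (@npatterns_le _ _ _ _ Am _ xpredT 0%N AmE) => //.
exists void, (fun v => of_void _ v); rewrite card_void; split=> // f [t [g [tX _ _]]].
by have := noal (t [::]); rewrite (treefam_alive row_nonempty (j := Ordinal k0) _ tX).
Qed.

Lemma npatterns_gt0 H a : alive E a -> (0 < npatterns K Am H)%N.
Proof.
move=> /(alive_treefam K predT)[f fP]; apply/card_gt0P.
exists [ffun h : seq_sub H => f (gmul K [::] (ssval h))]; rewrite inE; apply/asboolP.
exists f; split; first by apply/(shiftP _ _ AmE); have [-> _] := fP.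
by exists [::]; split=> // h; rewrite ffunE.
Qed.

End Bounds.

(** * Upper bounds for the patterns of translates *)

Section UpperBound.
Variables (R : realType) (k : nat) (K : 'I_k -> 'I_k -> bool).
Variables (Alph : finType) (E : Alph -> Alph -> bool) (m : nat).
Hypotheses (m0 : (0 < m)%N) (Km : forall i, #|K i| = m).
Local Notation S := (subtree_count E m).
Local Notation translates := (translates K E).

Lemma card_bigcup_rows (Q : {set 'I_k}) :
  (#|\bigcup_(j in Q) [set l | K j l]| <= #|Q| * m)%N.
Proof.
rewrite -sum_nat_const; apply: (big_ind2 (fun (X : {set 'I_k}) x => #|X| <= x)%N).
- by rewrite cards0.
- by move=> X x Y y Xx Yy; rewrite (leq_trans (leq_card_setU X Y)) ?leq_add.
by move=> j _; rewrite -(Km j) leq_eqVlt; apply/orP; left; apply/eqP/eq_card => l; rewrite inE.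
Qed.

Local Open Scope ring_scope.

(** Crude, but enough to move constant factors into the exponent. *)
Lemma natr_le_expR n : n%:R <= expR n%:R :> R.
Proof. by apply: le_trans (expR_ge1Dx _); rewrite lerDr. Qed.

Variables s C : R.
Hypotheses (s0 : 0 <= s) (C0 : 0 <= C).
Hypothesis SC : forall n, (S n)%:R <= expR (s * (geo m n.+1)%:R + C).

(* The letters of [Q] that cancel all lead to the parent node, whose view at
   depth [n] thus replaces up to [m] subtrees per cancelling letter. *)
Lemma translates_bound_linear : exists2 c : R, 0 <= c &
  forall n (Q : {set 'I_k}), exists2 N : nat,
    covered translates (wordball K (mem Q) n) N &
    N%:R <= expR (#|Q|%:R * (s * (geo m n)%:R) + c * n.+1%:R).
Proof.
(* The cost of one level: [C] for each of at most [k] prolonging letters, the root label, and the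
   [k.+1] possible values of the last letter. *)
pose c := k%:R * C + #|Alph|%:R + k.+1%:R.
have c0 : 0 <= c by rewrite !addr_ge0 ?mulr_ge0.
exists c => //; elim=> [|n IHn] Q.
  exists #|Alph|; first exact: covered_root.
  apply: le_trans (natr_le_expR _) _; rewrite ler_expR mulr0 mulr0 add0r mulr1 /c.
  have : 0 <= k%:R * C by rewrite mulr_ge0.
  have : 0 <= k.+1%:R :> R by [].
  lra.
pose Q1 (l : option 'I_k) := [set j in Q | appends K l j].
pose Q2 (l : option 'I_k) := [set j in Q | ~~ appends K l j].
pose Q' l := \bigcup_(j in Q2 l) [set l | K j l].
have /fin_all_exists2[N NP NB] : forall l, exists2 N : nat,
    covered translates (wordball K (mem (Q' l)) n) N &
    N%:R <= expR (#|Q' l|%:R * (s * (geo m n)%:R) + c * n.+1%:R).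
  by move=> l; apply: IHn.
pose F l f := translates f /\
  ((forall j, appends K l j -> subtree_family K E j (fun w => f (j :: w))) /\
  exists2 f', translates f' & forall j w, ~~ appends K l j -> f (j :: w) = f' w).
exists (\sum_l #|Alph| * S n ^ #|Q1 l| * N l)%N.
  apply: (@covered_sub _ _ _ (fun f => exists l, F l f)).
    by move=> f fP; have [l lP] := translates_split fP; exists l.
  apply: covered_union => l; apply: covered_step (NP l) _.
    by move=> j; apply: covered_subtree.
  by move=> f [].
pose B := #|Q|%:R * (s * (geo m n.+1)%:R) + k%:R * C + #|Alph|%:R + c * n.+1%:R.
have HB l : (#|Alph| * S n ^ #|Q1 l| * N l)%:R <= expR B.
  rewrite !natrM natrX.
  apply: le_trans (_ : expR #|Alph|%:R * expR (s * (geo m n.+1)%:R + C) ^+ #|Q1 l| *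
    expR (#|Q' l|%:R * (s * (geo m n)%:R) + c * n.+1%:R) <= _).
    rewrite ler_pM ?mulr_ge0 ?exprn_ge0 // ler_pM ?exprn_ge0 ?natr_le_expR //.
    by rewrite lerXn2r ?nnegrE ?expR_ge0.
  rewrite -expRM_natl -!expRD ler_expR /B.
  have cQ : (#|Q1 l| + #|Q2 l| = #|Q|)%N.
    rewrite -(cardsID [set j | appends K l j] Q); congr (_ + _)%N; apply: eq_card => j.
      by rewrite !inE.
    by rewrite !inE andbC.
  have Q1C : #|Q1 l|%:R * C <= k%:R * C.
    by rewrite ler_wpM2r // ler_nat -[k in (_ <= k)%N]card_ord max_card.
  (* The crucial comparison: a cancelling letter yields at most [m] subtrees at the parent, and
     [m * geo m n] is below [geo m n.+1]. *)
  have Q'Q2 : #|Q' l|%:R * (s * (geo m n)%:R) <= #|Q2 l|%:R * (s * (geo m n.+1)%:R).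
    rewrite mulrCA [leRHS]mulrCA ler_wpM2l // -!natrM ler_nat.
    apply: leq_trans (_ : #|Q2 l| * m * geo m n <= _)%N.
      by rewrite leq_mul2r card_bigcup_rows orbT.
    by rewrite -mulnA leq_mul2l /= leqnSn orbT.
  rewrite -cQ natrD mulrDl mulrDr; lra.
rewrite natr_sum; apply: le_trans (_ : \sum_(l : option 'I_k) expR B <= _).
  by apply: ler_sum => l _.
rewrite sumr_const card_option card_ord.
apply: le_trans (_ : expR k.+1%:R * expR B <= _).
  by rewrite -[leLHS]mulr_natl ler_wpM2r ?expR_ge0 ?natr_le_expR.
rewrite -expRD ler_expR /B.
have -> : c * n.+2%:R = c * n.+1%:R + c by rewrite -[n.+2]addn1 natrD mulrDr mulr1.
rewrite {3}/c; lra.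
Qed.

(** Nothing ever cancels, so every translate is the labelling of a genuine subtree; any letter
    serves as its root. *)
Lemma translates_bound_full : (forall i j, K i j) -> (0 < k)%N ->
  forall n Q, covered translates (wordball K Q n) (S n).
Proof.
move=> K1 k0 n Q.
have pth x w : path K x w by elim: w x => //= y w IH x; rewrite K1 IH.
have adm w : admissible K w by case: w => //= x w; apply: pth.
have okw (L : pred _) w : (forall j, L j) -> okword K L w by case: w => //= x w ->; rewrite pth.
have [I [r [cI rP]]] := covered_subtree E (Ordinal k0) n m0 Km.
exists I, r; split=> // f [t [g [[_ tE] gP ->]]].
have [|x xP] := rP (fun h => t (g ++ h)).
  exists (t g), (fun h => t (g ++ h)); split=> //; split; first by rewrite cats0.
  move=> w j _; rewrite -rcons_cat; apply: tE.
  exact: okw.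
exists x => w; rewrite wordballE => /andP[_ wn].
by rewrite gmul_cat // xP // wordballE okw.
Qed.

(** The error must be negligible against the ball size: for [m = 1] balls grow linearly, so only a
    constant is affordable. *)
Definition error_term (n : nat) : R := if m == 1%N then 1 else n.+1%:R.

Lemma translates_bound : (0 < k)%N -> (m = 1%N -> forall i j, K i j) ->
  exists2 c : R, 0 <= c &
  forall n (Q : {set 'I_k}), (0 < #|Q|)%N -> exists2 N : nat,
    covered translates (wordball K (mem Q) n) N &
    N%:R <= expR (#|Q|%:R * (s * (geo m n)%:R) + c * error_term n).
Proof.
rewrite /error_term => k0 m1; case: eqP => [mE|_]; last first.
  have [c c0 cP] := translates_bound_linear; exists c => // n Q _; exact: cP.
(* For [m = 1], [geo m n.+1] exceeds [geo m n] by one node, which costs [s]. *)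
exists (s + C); first by rewrite addr_ge0.
move=> n Q Q0; exists (S n); first by apply: translates_bound_full => //; apply: m1.
apply: le_trans (SC n) _; rewrite ler_expR mulr1 addrA lerD2r.
have -> : (geo m n.+1)%:R = (geo m n)%:R + 1 :> R by rewrite /= {1}mE mul1n -addn1 natrD.
rewrite mulrDr mulr1 lerD2r ler_peMl ?mulr_ge0 //.
by rewrite ler1n.
Qed.

End UpperBound.

(** * Growth rates of real sequences *)

Section Growth.
Variable R : realType.
Local Open Scope ring_scope.
Local Open Scope classical_set_scope.

(** The finitely many exceptional values are absorbed by their sum. *)
Lemma bounded_up_to_constant (u v : nat -> R) N :
  (forall n, 0 <= u n) -> (forall n, 0 <= v n) -> (forall n, (N <= n)%N -> u n <= v n) ->
  exists2 C : R, 0 <= C & forall n, u n <= v n + C.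
Proof.
move=> u0 v0 uv; have S0 : 0 <= \sum_(i < N) u i by exact: sumr_ge0.
exists (\sum_(i < N) u i) => // n; have [nN|Nn] := ltnP n N; last first.
  by rewrite (le_trans (uv _ Nn)) // lerDl.
rewrite (bigD1 (Ordinal nN)) //= addrCA lerDl addr_ge0 //.
exact: sumr_ge0.
Qed.

Lemma geoE m n : ((m%:R - 1) * (geo m n)%:R + 1 = m%:R ^+ n :> R).
Proof.
elim: n => [|n IHn] /=; first by rewrite mulr0 add0r.
by rewrite exprS -IHn -addn1 natrD natrM; ring.
Qed.

(** The additive [C] makes the estimate valid at every [n], as the induction on depth requires. *)
Definition has_growth_rate (m : nat) (x : nat -> R) (h : R) : Prop :=
  forall e, 0 < e -> exists2 C : R, 0 <= C &
    forall n, `|x n - h * (geo m n.+1)%:R| <= e * (geo m n.+1)%:R + C.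

Lemma growth_rate_geometric m (x : nat -> R) c : (1 < m)%N -> 0 <= c ->
  (forall n, 0 <= x n) -> (forall n, x n.+1 <= m%:R * x n + c) ->
  exists2 h, 0 <= h & has_growth_rate m x h.
Proof.
move=> m1 c0 x0 xS; pose M : R := m%:R.
have M2 : 2 <= M by rewrite ler_nat.
have Mn0 n : 0 < M ^+ n by rewrite exprn_gt0 //; lra.
pose y n := (x n + c) / M ^+ n.
have y0 n : 0 <= y n by rewrite divr_ge0 ?addr_ge0 // ltW.
have ydecr : {homo y : n p / (n <= p)%N >-> p <= n}.
  apply/nonincreasing_seqP => n; rewrite /y ler_pdivrMr // exprS.
  have -> : (x n + c) / M ^+ n * (M * M ^+ n) = M * (x n + c).
    by have := Mn0 n => /gt_eqF/negbT ?; field.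
  have := xS n; rewrite -/M mulrDr => xSn.
  (* This is where [m > 1] enters: one [c] pays for the recursion, the other for the shift in
     [y]. *)
  have : 2 * c <= M * c by rewrite ler_wpM2r.
  lra.
have ycvg : y @ \oo --> limn y.
  by apply: nonincreasing_is_cvgn => //; exists 0 => _ [n _ <-].
set l := limn y in ycvg.
have l0 : 0 <= l by apply: limr_ge; [apply/cvg_ex; exists l|near=> n].
(* [geo m n.+1] is asymptotic to [M ^+ n.+1 / (M - 1)], so the limit [l] relative to [M ^+ n] is
   rescaled. *)
exists (l * (M - 1) / M); first by rewrite divr_ge0 ?mulr_ge0 //; lra.
move=> e e0; have /cvgrPdist_le /(_ e e0) [N _ yN] := ycvg.
have [|n|n Nn|C C0 CP] := @bounded_up_to_constant
    (fun n => `|x n - l * (M - 1) / M * (geo m n.+1)%:R|)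
    (fun n => e * (geo m n.+1)%:R + (c + l)) N.
- by move=> n.
- by rewrite addr_ge0 ?addr_ge0 ?mulr_ge0 // ltW.
- have yn : `|l - y n| <= e by exact: (yN n Nn).
  rewrite /y in yn.
  have {}yn : `|l * M ^+ n - (x n + c)| <= e * M ^+ n.
    have -> : l * M ^+ n - (x n + c) = (l - (x n + c) / M ^+ n) * M ^+ n.
      by have := Mn0 n => /gt_eqF/negbT ?; field.
    by rewrite normrM [X in _ * X]gtr0_norm // ler_wpM2r // ltW.
  have := geoE m n.+1; rewrite -/M exprS => geoM.
  have -> : l * (M - 1) / M * (geo m n.+1)%:R = l * M ^+ n - l / M.
    have -> : l * M ^+ n = l / M * (M * M ^+ n) by field; lra.
    by rewrite -geoM; ring.
  have lM : 0 <= l / M <= l.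
    by rewrite divr_ge0 //= ?ler_pdivrMr ?ler_peMr //; lra.
  have : e * M ^+ n <= e * (geo m n.+1)%:R.
    rewrite ler_wpM2l //; first exact: ltW.
    have : 0 <= (geo m n)%:R :> R by [].
    by have := geoE m n; rewrite -/M /= -addn1 natrD natrM -/M => <-; lra.
  by move: yn lM; rewrite !ler_norml => /andP[y1 y2] /andP[l1 l2] Me; apply/andP; split; lra.
exists (c + l + C); first by rewrite !addr_ge0.
by move=> n; rewrite addrA.
Unshelve. all: end_near. Qed.

Lemma geo1 n : geo 1 n = n.
Proof. by elim: n => //= n ->; rewrite mul1n. Qed.

(** Fekete's argument: the rate is the infimum of [x n / n] over positive [n], approached by
    division with remainder. *)
Lemma growth_rate_subadditive (x : nat -> R) :
  (forall n, 0 <= x n) -> (forall n l, x (n + l)%N <= x n + x l) ->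
  exists2 h, 0 <= h & has_growth_rate 1 x h.
Proof.
move=> x0 xD; pose A := range (fun n => x n.+1 / n.+1%:R).
have Ainf : has_inf A.
  split; first by exists (x 1%N / 1%:R), 0%N.
  by exists 0 => _ [n _ <-]; rewrite divr_ge0.
have hle n : inf A * n%:R <= x n.
  case: n => [|n]; first by rewrite mulr0.
  by rewrite -ler_pdivlMr //; apply: ge_inf; [case: Ainf | exists n].
have h0 : 0 <= inf A.
  by apply: lb_le_inf; [case: Ainf | move=> _ [n _ <-]; rewrite divr_ge0].
exists (inf A) => // e e0.
have [_ [N _ <-] xN] := inf_adherent e0 Ainf.
have xmul q i : x (q * N.+1 + i)%N <= q%:R * x N.+1 + x i.
  elim: q => [|q IHq]; first by rewrite mul0r add0r.
  by rewrite mulSn -addnA (le_trans (xD _ _)) // -(addn1 q) natrD; lra.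
rewrite ltr_pdivrMr // in xN.
have [|n|C C0 CP] := @bounded_up_to_constant (fun n => if (n < N.+1)%N then x n else 0)
    (fun=> 0) N.+1 _ (fun=> lexx 0).
- by move=> n; case: ifP.
- by move=> Nn; rewrite ltnNge Nn.
(* [C] bounds the remainders; [inf A] pays for [geo 1 n.+1] being [n.+1] rather than [n]. *)
exists (inf A + C); first by rewrite addr_ge0.
move=> n; rewrite geo1.
have xn : x n <= (inf A + e) * n%:R + C.
  have := xmul (n %/ N.+1)%N (n %% N.+1)%N; rewrite -divn_eq => xq.
  have := CP (n %% N.+1)%N; rewrite ltn_pmod // add0r => xr.
  have : (n %/ N.+1)%:R * x N.+1 <= (inf A + e) * n%:R.
    apply: le_trans (_ : (n %/ N.+1)%:R * ((inf A + e) * N.+1%:R) <= _).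
      by rewrite ler_wpM2l // ltW.
    rewrite mulrCA ler_wpM2l //; first by rewrite addr_ge0 // ltW.
    by rewrite -natrM ler_nat leq_divM.
  lra.
by have := hle n; rewrite ler_norml -addn1 natrD => hn; apply/andP; split; lra.
Qed.

(** The bound on [n.+1%:R * r n] makes the error [r] negligible against [s]. *)
Lemma ratio_cvg (y s r : nat -> R) h :
  (forall n, 0 < s n) -> (forall n, 0 <= r n) -> (forall n, n.+1%:R * r n <= 2 * s n) ->
  (forall e, 0 < e -> exists2 C : R, 0 <= C &
     forall n, `|y n - h * s n| <= e * s n + C * r n) ->
  (fun n => y n / s n) @ \oo --> h.
Proof.
move=> s0 r0 rs ys; apply/cvgrPdist_le => e e0.
have [|C C0 CP] := ys (e / 2); first by rewrite divr_gt0.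
near=> n.
have -> : h - y n / s n = - ((y n - h * s n) / s n).
  by have /gt_eqF/negbT ? := s0 n; field.
rewrite normrN normrM [X in _ * X]gtr0_norm ?invr_gt0 // ler_pdivrMr //.
apply: le_trans (CP n) _.
(* From here on [C * r n] is at most half of [e * s n]. *)
have nC : 4 * C / e <= n%:R by near: n; exact: nbhs_infty_ger.
have {}nC : 4 * C <= e * n.+1%:R.
  by rewrite ler_pdivrMr // in nC; rewrite -addn1 natrD; lra.
have : 4 * C * r n <= e * n.+1%:R * r n by rewrite ler_wpM2r.
have : e * (n.+1%:R * r n) <= e * (2 * s n) by rewrite ler_wpM2l // ltW.
lra.
Unshelve. all: end_near. Qed.

End Growth.

(** * Asymptotics of the pattern counts *)

Section Entropy.
Variables (R : realType) (k : nat) (K : 'I_k -> 'I_k -> bool).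
Variables (Alph : finType) (E : Alph -> Alph -> bool) (Am : 'I_k -> Alph -> Alph -> bool).
Hypothesis AmE : forall i, Am i = E.
Variables (m : nat) (a0 : Alph).
Hypotheses (m0 : (0 < m)%N) (Km : forall i, #|K i| = m).
Hypotheses (k0 : (0 < k)%N) (m1 : m = 1%N -> forall i j, K i j).
Hypothesis alive_a0 : alive E a0.
Local Notation S := (subtree_count E m).
Local Notation z n a := (\sum_(b | E a b) tcount E m n b).
Local Notation error := (error_term R m).

Lemma leq_geo n : (n.+1 <= geo m n.+1)%N.
Proof.
elim: n => // n IHn; rewrite [geo _ _]/= ltnS (leq_trans IHn) //.
by rewrite -[X in (X <= _)%N]mul1n leq_mul2r m0 orbT.
Qed.

Local Open Scope ring_scope.

Lemma error_ge1 n : 1 <= error n.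
Proof. by rewrite /error_term; case: ifP => // _; rewrite ler1n. Qed.

Lemma error_small n : n.+1%:R * error n <= 2 * (geo m n.+1)%:R.
Proof.
rewrite /error_term; case: eqP => [_|m_neq1].
  rewrite mulr1; apply: le_trans (_ : (geo m n.+1)%:R <= _).
    by rewrite ler_nat leq_geo.
  by rewrite ler_peMl // ler1n.
rewrite -!natrM ler_nat; have m2 : (2 <= m)%N by lia.
elim: n => // n IHn.
have : (2 * geo m n.+1 <= m * geo m n.+1)%N by rewrite leq_mul2r m2 orbT.
rewrite [geo m n.+2]/= -/(geo m n.+1); nia.
Qed.

(** A semiball of depth [n] lies in a ball of depth [n.+1] about the identity. *)
Lemma error_succ n : error n.+1 <= 2 * error n.
Proof.
rewrite /error_term; case: ifP => _; first by rewrite mulr1 ler1n.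
by rewrite -natrM ler_nat; lia.
Qed.

Lemma S_gt0 n : 0 < (S n)%:R :> R.
Proof. by rewrite ltr0n (subtree_count_gt0 m n alive_a0). Qed.

Lemma ln_nat_ge0 n : 0 <= ln n%:R :> R.
Proof. by case: n => [|n]; [rewrite ln0 | rewrite ln_ge0 // ler1n]. Qed.

Lemma alph_gt0 : (0 < #|Alph|)%N.
Proof. by apply/card_gt0P; exists a0. Qed.

Lemma subtree_growth_rate :
  exists2 h : R, 0 <= h & has_growth_rate m (fun n => ln (S n)%:R) h.
Proof.
case: (ltnP 1 m) => [m2|m_le1].
  apply: (growth_rate_geometric (c := ln #|Alph|%:R) m2 (ln_nat_ge0 _)) => n.
    exact: ln_nat_ge0.
  rewrite mulr_natl -lnXn ?S_gt0 // addrC -lnM ?posrE ?exprn_gt0 ?S_gt0 ?ltr0n ?alph_gt0 //.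
  rewrite ler_ln ?posrE ?mulr_gt0 ?exprn_gt0 ?S_gt0 ?ltr0n ?alph_gt0 //.
  by rewrite -natrX -natrM ler_nat subtree_count_step.
have mE : m = 1%N by lia.
rewrite [X in has_growth_rate X]mE; apply: growth_rate_subadditive => [n|n l].
  exact: ln_nat_ge0.
rewrite -lnM ?posrE ?S_gt0 // ler_ln ?posrE ?mulr_gt0 ?S_gt0 //.
by rewrite -natrM ler_nat subtree_count_submul.
Qed.

(** The cover bound is applied with [s := h + e], which the growth rate of [S] permits. *)
Lemma npatterns_upper (h e : R) : 0 <= h -> has_growth_rate m (fun n => ln (S n)%:R) h ->
  0 < e -> exists2 c, 0 <= c & forall n (Q : {set 'I_k}) (H : seq (seq 'I_k)), (0 < #|Q|)%N ->
  {subset H <= wordball K (mem Q) n} ->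
  ln (npatterns K Am H)%:R <= #|Q|%:R * ((h + e) * (geo m n)%:R) + c * error n.
Proof.
move=> h0 hS e0; have [C C0 CP] := hS e e0.
have he : 0 <= h + e by rewrite addr_ge0 // ltW.
have [n|c c0 cP] := translates_bound (R := R) m0 Km he C0 _ k0 m1 (E := E).
  rewrite -[X in X <= _](lnK (S_gt0 n)) ler_expR.
  by have := CP n; rewrite ler_norml => /andP[_]; lra.
exists c => // n Q H Q0 HQ; have [N NP NB] := cP n Q Q0.
rewrite -[leRHS]expRK ler_ln ?posrE ?expR_gt0 ?ltr0n ?(npatterns_gt0 K AmE H alive_a0) //.
by apply: le_trans NB; rewrite ler_nat (npatterns_le AmE NP).
Qed.

Lemma subtree_lower (h e : R) : has_growth_rate m (fun n => ln (S n)%:R) h -> 0 < e ->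
  exists2 C, 0 <= C & forall n, exists a, (0 < z n a)%N /\
    (h - e) * (1 + m%:R * (geo m n.+1)%:R) - C <= m%:R * ln (z n a)%:R.
Proof.
move=> hS e0; have [C C0 CP] := hS e e0.
exists (C + ln #|Alph|%:R); first by rewrite addr_ge0 ?ln_nat_ge0.
move=> n; have [a aP] := subtree_count_max E m0 n a0; exists a.
have z0 : (0 < z n a)%N.
  rewrite lt0n; apply: contraTN aP => /eqP->.
  by rewrite exp0n // muln0 -ltnNge (subtree_count_gt0 m n.+1 alive_a0).
split=> //.
have : ln (S n.+1)%:R <= ln #|Alph|%:R + m%:R * ln (z n a)%:R :> R.
  rewrite mulr_natl -lnXn ?ltr0n // -lnM ?posrE ?exprn_gt0 ?ltr0n ?alph_gt0 //.
  rewrite ler_ln ?posrE ?mulr_gt0 ?exprn_gt0 ?S_gt0 ?ltr0n ?alph_gt0 //.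
  by rewrite -natrX -natrM ler_nat.
have := CP n.+1; have -> : (geo m n.+2)%:R = 1 + m%:R * (geo m n.+1)%:R :> R.
  by rewrite [geo m n.+2]/= -add1n natrD natrM.
rewrite ler_norml => /andP[+ _]; lra.
Qed.

Lemma p_n_asymptotics (h : R) : 0 <= h -> has_growth_rate m (fun n => ln (S n)%:R) h ->
  forall e, 0 < e -> exists2 C : R, 0 <= C & forall n,
  `|ln (p_n K Am n)%:R - h * (size (Delta K n))%:R|
    <= e * (size (Delta K n))%:R + C * error n.
Proof.
move=> h0 hS e e0.
have [c c0 cP] := npatterns_upper h0 hS e0.
have [C C0 CP] := subtree_lower hS e0.
pose M : R := m%:R; pose L : R := k%:R.
have M1 : 1 <= M by rewrite ler1n.
have L1 : 1 <= L by rewrite ler1n.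
(* [c] serves the upper bound; the rest serves the lower one, where [L * (1 + M * g)] is compared
   with [M * (1 + L * g)]. *)
pose D := c + ((h + e) * (M + L) + L * C).
have D1 : 0 <= (h + e) * (M + L) by rewrite mulr_ge0; lra.
have D2 : 0 <= L * C by rewrite mulr_ge0; lra.
have D0 : 0 <= D by rewrite /D; lra.
exists D => // n; rewrite (size_Delta Km) natrD natrM -/L; set g := (geo m n)%:R.
have g0 : 0 <= g by [].
have r1 := error_ge1 n; rewrite ler_norml; apply/andP; split; last first.
  have := cP n [set: 'I_k] (Delta K n); rewrite cardsT card_ord -/L -/g => /(_ k0) up.
  have {}up : ln (p_n K Am n)%:R <= L * ((h + e) * g) + c * error n.
    apply: up => w; rewrite mem_Delta !wordballE => /andP[wP ->]; rewrite andbT.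
    by case: w wP => //= j w; rewrite inE.
  have : c * error n <= D * error n by rewrite ler_wpM2r //; rewrite /D; lra.
  lra.
have Dr : D <= D * error n by rewrite ler_peMr.
case: n @g g0 r1 Dr => [|n] g g0 r1 Dr.
  (* The lower bound by [z] starts at depth one; at depth zero [D] alone dominates [h]. *)
  have := ln_nat_ge0 (p_n K Am 0).
  have : 0 <= (h + e) * (M + L - 1) by rewrite mulr_ge0; lra.
  rewrite /D in Dr *; rewrite /g /=; lra.
have [a [z0 za]] := CP n; rewrite -/M -/g in za.
have : L * ln (z n a)%:R <= ln (p_n K Am n.+1)%:R.
  rewrite /L mulr_natl -lnXn ?ltr0n // ler_ln ?posrE ?exprn_gt0 ?ltr0n //.
    by rewrite -natrX ler_nat; apply: p_n_ge.
  exact: (npatterns_gt0 K AmE _ alive_a0).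
set lz := ln _ in za *; set lp := ln _ => zp.
have zaL : L * ((h - e) * (1 + M * g) - C) <= L * (M * lz) by rewrite ler_wpM2l //; lra.
have zpM : M * (L * lz) <= M * lp by rewrite ler_wpM2l //; lra.
have Mpos : 0 < M by lra.
rewrite -(ler_pM2l Mpos).
have : M * D <= M * (D * error n.+1) by rewrite ler_wpM2l //; lra.
have : (M - 1) * D >= 0 by rewrite mulr_ge0 //; lra.
have : 0 <= h * M by rewrite mulr_ge0; lra.
have : 0 <= e * L by rewrite mulr_ge0; lra.
have : 0 <= h * L by rewrite mulr_ge0; lra.
have : 0 <= e * M by rewrite mulr_ge0; lra.
rewrite /D; lra.
Qed.

Lemma p_n_semi_asymptotics (h : R) i : 0 <= h -> has_growth_rate m (fun n => ln (S n)%:R) h ->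
  forall e, 0 < e -> exists2 C : R, 0 <= C & forall n,
  `|ln (p_n_semi K Am [:: i] n)%:R - h * (size (semiball K [:: i] n))%:R|
    <= e * (size (semiball K [:: i] n))%:R + C * error n.
Proof.
move=> h0 hS e e0.
have [c c0 cP] := npatterns_upper h0 hS e0.
have [C C0 CP] := subtree_lower hS e0.
pose M : R := m%:R; have M1 : 1 <= M by rewrite ler1n.
(* [2 * c] comes from the shift in depth, [C] from the lower bound, and [e] from the extra root node
   there. *)
pose D := 2 * c + C + e.
have D0 : 0 <= D by rewrite /D; lra.
exists D => // n; rewrite (size_semiball Km); set g := (geo m n.+1)%:R.
have r1 := error_ge1 n; rewrite ler_norml; apply/andP; split; last first.
  have := cP n.+1 [set i] (semiball K [:: i] n); rewrite cards1 -/g mul1r => /(_ isT) up.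
  have {}up : ln (p_n_semi K Am [:: i] n)%:R <= (h + e) * g + c * error n.+1.
    apply: up => -[|j w]; rewrite mem_semiball // => /andP[/eqP-> wP].
    by rewrite wordball_cons wP andbT; apply: set11.
  have : c * error n.+1 <= c * (2 * error n) by rewrite ler_wpM2l // error_succ.
  have : 0 <= (C + e) * error n by rewrite mulr_ge0; lra.
  rewrite /D; lra.
have Dr : D <= D * error n by rewrite ler_peMr.
have [a [z0 za]] := CP n; rewrite -/M -/g in za.
have : ln (z n a)%:R <= ln (p_n_semi K Am [:: i] n)%:R :> R.
  rewrite ler_ln ?posrE ?ltr0n //; last exact: (npatterns_gt0 K AmE _ alive_a0).
  by rewrite ler_nat; apply: p_n_semi_ge.
set lz := ln _ in za *; set lp := ln _ => zp.
have zpM : M * lz <= M * lp by rewrite ler_wpM2l //; lra.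
have Mpos : 0 < M by lra.
rewrite -(ler_pM2l Mpos).
have : M * D <= M * (D * error n) by rewrite ler_wpM2l //; lra.
have : (M - 1) * D >= 0 by rewrite mulr_ge0 //; lra.
rewrite /D; lra.
Qed.

Local Open Scope classical_set_scope.

Lemma entropy_cvg : exists h : R, entropy_seq R K Am @ \oo --> h /\
  forall i, stem_seq R K Am i @ \oo --> h.
Proof.
have [h h0 hS] := subtree_growth_rate; exists h.
have r0 n : 0 <= error n by apply: le_trans (error_ge1 n).
split=> [|i]; apply: (ratio_cvg (r := error)) => //.
- by move=> n; rewrite (size_Delta Km) ltr0n.
(* A row has at most [k] ones, so [m <= k] and [Delta] has at least [geo m n.+1] elements. *)
- move=> n; apply: le_trans (error_small n) _; rewrite ler_wpM2l // ler_nat.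
  rewrite (size_Delta Km) /= add1n ltnS leq_mul2r.
  rewrite -(Km (Ordinal k0)) -[X in (_ <= X)%N]card_ord max_card.
  by rewrite orbT.
- exact: p_n_asymptotics.
- by move=> n; rewrite (size_semiball Km) ltr0n.
- by move=> n; rewrite (size_semiball Km); apply: error_small.
exact: p_n_semi_asymptotics.
Qed.

End Entropy.

(** * The entropy theorem, with its degenerate cases *)

Local Open Scope ring_scope.

Theorem theorem4p3 (R : realType) (k : nat) (K : 'I_k -> 'I_k -> bool)
    (Alph : finType) (Am : 'I_k -> Alph -> Alph -> bool) :
  primitive_mx (mx_of_rel K) ->
  (exists m : nat, forall i : 'I_k, (\sum_(j < k) (K i j : nat))%N = m) ->
  (forall i j : 'I_k, Am i = Am j) ->
  cvgn (entropy_seq R K Am) /\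
  forall i : 'I_k, (limn (entropy_seq R K Am))%:E = stem_entropy R K Am i.
Proof.
move=> Kprim [m Krow] AmE.
(* A common real limit suffices, since a convergent sequence has its limit as limsup. *)
suff [h [hE hS]] : exists h : R, (entropy_seq R K Am @ \oo --> h)%classic /\
    forall i, (stem_seq R K Am i @ \oo --> h)%classic.
  split; first by apply/cvg_ex; exists h.
  move=> i; have -> : limn (entropy_seq R K Am) = h by apply/cvg_lim.
  have /cvg_limn_einf_sup[_ esup] :
      ((stem_seq R K Am i n)%:E @[n --> \oo] --> h%:E)%classic.
    by apply: cvg_EFin; [exact: nearW | exact: hS].
  by rewrite /stem_entropy esup.
have Km i : #|K i| = m by rewrite -row_card.
(* Without generators [G] is trivial: the sequence is constant and there are no stems. *)
case: (posnP k) => [k_eq0|k0].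
  exists (entropy_seq R K Am 0); split; last by move=> i; have := ltn_ord i; rewrite {2}k_eq0.
  suff D n : Delta K n = [:: [::]].
    have -> : entropy_seq R K Am = fun=> entropy_seq R K Am 0.
      by apply/funext => n; rewrite /entropy_seq /p_n !D.
    exact: cvg_cst.
  have := size_Delta Km n; rewrite [in RHS]k_eq0 mul0n.
  have := mem_Delta K n [::]; case: (Delta K n) => [|w [|]] //=.
  by rewrite inE => /eqP<-.
have AmE' i : Am i = Am (Ordinal k0) by apply: AmE.
have [p p0 kp] := primitive_card_le Km Kprim.
have m0 : (0 < m)%N.
  by rewrite lt0n; apply/eqP => mE; have := kp k0; rewrite mE exp0n // leqNgt k0.
have m1 : m = 1%N -> forall i j, K i j.
  move=> mE i j; have k1 : (k <= 1)%N by have := kp k0; rewrite mE exp1n.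
  have /card_gt0P[l Kl] : (0 < #|K i|)%N by rewrite Km.
  suff -> : j = l by [].
  by apply/val_inj => /=; have := ltn_ord j; have := ltn_ord l; lia.
case: (pselect (exists a, alive (Am (Ordinal k0)) a)) => [[a al]|dead].
  exact: entropy_cvg AmE' _ _ m0 Km k0 m1 al.
have no H : npatterns K Am H = 0%N.
  by apply: (no_patterns AmE' m0 Km H k0) => a; apply/negP => al; apply: dead; exists a.
(* The shift is empty, and by the convention [ln 0 = 0] both sequences vanish. *)
exists 0; split=> [|i].
  have -> : entropy_seq R K Am = fun=> 0.
    by apply/funext => n; rewrite /entropy_seq /p_n no ln0 // mul0r.
  exact: cvg_cst.
have -> : stem_seq R K Am i = fun=> 0.
  by apply/funext => n; rewrite /stem_seq /p_n_semi no ln0 // mul0r.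
exact: cvg_cst.
Qed.
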